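(* Let $G:\mathbb{R}\to[0,1]$ be a right-continuous, monotone non-decreasing function with $\lim_{x\to-\infty}G(x)=0$, $\lim_{x\to\infty}G(x)=1$, and $G(x)=1-G(-x)$ for all $x\in\mathbb{R}$. Then $$\mathbf{G}=\int_{-1}^{1}\frac{G(x)\tan^{-1}x}{x}\,dx,$$ where $\mathbf{G}=\sum_{n=0}^{\infty}\frac{(-1)^n}{(2n+1)^2}$ is Catalan's constant.
   Context: Catalan's constant is $\mathbf{G}=\sum_{n=0}^{\infty}\frac{(-1)^n}{(2n+1)^2}$. The integrand $\frac{\tan^{-1}x}{x}$ is understood to equal $1$ at $x=0$. *)

(* Defs.v *)
From HB Require Import structures.
From mathcomp Require Import all_boot all_order all_algebra.
From mathcomp Require Import all_classical all_reals all_analysis.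
From mathcomp Require Import lra ring.
Set Implicit Arguments.
Unset Strict Implicit.
Unset Printing Implicit Defensive.
Import Order.TTheory GRing.Theory Num.Theory.
Import numFieldNormedType.Exports.
Local Open Scope classical_set_scope.
Local Open Scope ring_scope.

Definition catalan_term (R : realType) (n : nat) : R :=
  (-1) ^+ n / (2 * n + 1)%:R ^+ 2.

(* limn is total; is_cvg_catalan shows that this is a genuine limit. *)
Definition catalan (R : realType) : R := limn (series (@catalan_term R)).

Definition atan_div (R : realType) (x : R) : R :=
  if x == 0 then 1 else atan x / x.

Lemma is_cvg_catalan (R : realType) : cvgn (series (@catalan_term R)).
Proof.
apply: (@normed_cvg R R).
pose v (n : nat) : R := 2 * (n.+1%:R^-1 - n.+2%:R^-1).
have vge n : `|catalan_term R n| <= v n.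
  rewrite /catalan_term normrM normrX normrN1 expr1n mul1r normfV.
  rewrite ger0_norm ?exprn_ge0 ?ler0n// /v.
  have n0 : 0 <= n%:R :> R by rewrite ler0n.
  rewrite natrD natrM -[n.+2]addn2 -[n.+1]addn1 !natrD.
  move: (n%:R : R) n0 => y y0.
  rewrite -subr_ge0.
  have -> : 2 * ((y + 1)^-1 - (y + 2)^-1) - ((2 * y + 1) ^+ 2)^-1
    = (7 * y ^+ 2 + 5 * y) / ((y + 1) * (y + 2) * (2 * y + 1) ^+ 2).
    by field; rewrite !gt_eqF//; lra.
  by rewrite divr_ge0// ?addr_ge0 ?mulr_ge0 ?exprn_ge0//; lra.
have nge n : 0 <= `|catalan_term R n| by [].
apply: (@series_le_cvg R _ v nge _ vge).
  by move=> n; exact: le_trans (nge n) (vge n).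
apply: nondecreasing_is_cvgn.
  by apply: nondecreasing_series => n _ _; exact: le_trans (nge n) (vge n).
exists 2 => _ [n _ <-].
suff -> : series v n = 2 * (1 - n.+1%:R^-1).
  have : 0 <= n.+1%:R^-1 :> R by rewrite invr_ge0 ler0n.
  by move: (n.+1%:R^-1 : R) => y y0; lra.
elim: n => [|n IH]; first by rewrite /series /= big_geq// invr1 subrr mulr0.
rewrite /series /= big_nat_recr//=; move: IH; rewrite /series /= => ->.
by rewrite /v; ring.
Qed.

(* Main.v *)
Require Import Defs.
From mathcomp Require Import all_boot all_order all_algebra.
From mathcomp Require Import all_classical all_reals all_analysis.
From mathcomp Require Import measurable_realfun lra ring.
Import Order.TTheory GRing.Theory Num.Theory.
Import numFieldNormedType.Exports.
Local Open Scope classical_set_scope.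
Local Open Scope ring_scope.

(** Since [atan x / x] is even and [G x + G (- x) = 1], only the weight 1/2 of
    [G] matters when it is integrated against an even function on [-1, 1].
    The Taylor polynomials of [atan x / x] are even and converge uniformly on
    [-1, 1]; half of the integral of the [N]-th one is the [N]-th partial sum of
    Catalan's series, and dominated convergence concludes. *)

Definition atan_div_poly (R : realType) (N : nat) : {poly R} :=
  \sum_(n < N) ((-1) ^+ n / (2 * n + 1)%:R) *: 'X^(2 * n).

Definition atan_div_primitive (R : realType) (N : nat) : {poly R} :=
  \sum_(n < N) catalan_term R n *: 'X^(2 * n + 1).

Lemma odd_natr_neq0 (R : realType) (n : nat) : (2 * n + 1)%:R != 0 :> R.
Proof. by rewrite pnatr_eq0 addn1. Qed.

Lemma derivZXn (R : realType) (c : R) (n : nat) :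
  (c *: 'X^(n + 1))^`() = (c * (n + 1)%:R) *: 'X^n.
Proof. by rewrite derivZ derivXn addn1 /= -scaler_nat scalerA. Qed.

Lemma deriv_atan_div_primitive (R : realType) (N : nat) :
  (atan_div_primitive R N)^`() = atan_div_poly R N.
Proof.
rewrite /atan_div_primitive raddf_sum /=; apply: eq_bigr => n _.
rewrite derivZXn; congr (_ *: _); rewrite /catalan_term.
by have := odd_natr_neq0 R n => h; field.
Qed.

Lemma hornerN_atan_div_poly (R : realType) (N : nat) (x : R) :
  (atan_div_poly R N).[- x] = (atan_div_poly R N).[x].
Proof.
rewrite /atan_div_poly !horner_sum; apply: eq_bigr => n _.
by rewrite !hornerE !exprM sqrrN.
Qed.

Lemma hornerN_atan_div_primitive (R : realType) (N : nat) (x : R) :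
  (atan_div_primitive R N).[- x] = - (atan_div_primitive R N).[x].
Proof.
rewrite /atan_div_primitive !horner_sum -sumrN; apply: eq_bigr => n _.
by rewrite !hornerE addn1 !exprS !exprM sqrrN mulNr mulrN.
Qed.

Lemma atan_div_primitive1 (R : realType) (N : nat) :
  (atan_div_primitive R N).[1] = series (@catalan_term R) N.
Proof.
rewrite /atan_div_primitive horner_sum /series /= big_mkord.
by apply: eq_bigr => n _; rewrite !hornerE expr1n mulr1.
Qed.

(** Differentiating [X] times the polynomial cancels the denominators [2n+1] and leaves the
    geometric sum of the powers of [-x^2]. The induction runs on the identity multiplied by
    [1 + x^2]. *)
Lemma horner_deriv_X_atan_div_poly (R : realType) (N : nat) (x : R) :
  ('X * atan_div_poly R N)^`().[x] =
  (1 - (- x ^+ 2) ^+ N) * (1 + x ^+ 2)^-1.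
Proof.
have x2 : 1 + x ^+ 2 != 0 by rewrite gt_eqF// ltr_wpDr// sqr_ge0.
apply: (mulIf x2); rewrite mulfVK//.
elim: N => [|N IH].
  by rewrite /atan_div_poly big_ord0 mulr0 derivC hornerC mul0r expr0 subrr.
rewrite /atan_div_poly big_ord_recr /= -/(atan_div_poly R N) (mulrDr 'X).
rewrite derivD hornerD mulrDl IH -scalerAr -exprS -[(2 * N).+1%N]addn1 derivZXn hornerZ.
rewrite hornerXn mulfVK ?odd_natr_neq0//.
(* The sign is split off so that it squares to 1 against the sign of the coefficient. *)
have -> : x ^+ (2 * N) = (-1) ^+ N * (- x ^+ 2) ^+ N.
  by rewrite -exprMn mulN1r opprK exprM.
by rewrite mulrA -expr2 sqrr_sign [in RHS](exprS _ N); ring.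
Qed.

(** Here [s] is a sign: [s = 1] and [s = -1] give the two halves of an absolute value bound. The gap
    [f] between the two sides vanishes at 0 and is nondecreasing on [[0, x]], because the remainder
    has derivative [(-y^2)^N / (1 + y^2)], at most [y^(2N)] in absolute value. *)
Lemma atan_taylor_bound (R : realType) (N : nat) (s x : R) :
  0 <= x -> s ^+ 2 = 1 ->
  s * (atan x - x * (atan_div_poly R N).[x]) <= x ^+ (2 * N + 1) / (2 * N + 1)%:R.
Proof.
move=> x0 s1.
pose q : {poly R} := 'X * atan_div_poly R N.
pose e : {poly R} := (2 * N + 1)%:R^-1 *: 'X^(2 * N + 1).
pose f : R -> R := horner e - s \*: ((@atan R) - horner q).
have df (y : R) : is_derive y (1 : R) f
    (e^`().[y] - s *: ((1 + y ^+ 2)^-1 - q^`().[y])).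
  by apply: is_deriveB; apply: is_deriveZ.
have eE y : e^`().[y] = (y ^+ 2) ^+ N.
  by rewrite derivZXn hornerZ hornerXn mulVf ?odd_natr_neq0// mul1r exprM.
have fE y : f y = y ^+ (2 * N + 1) / (2 * N + 1)%:R
    - s * (atan y - y * (atan_div_poly R N).[y]).
  transitivity (e.[y] - s * (atan y - q.[y])) => //.
  by rewrite /e /q hornerZ hornerXn hornerM hornerX mulrC.
have : f 0 <= f x.
  apply: (@ger0_derive1_ndecr R f 0 x) => //.
  - move=> y _; rewrite derive1E; have -> := @derive_val _ _ _ _ _ _ _ (df y).
    rewrite eE horner_deriv_X_atan_div_poly.
    move: (y ^+ 2) (sqr_ge0 y) => z z0.
    have iz0 : 0 <= (1 + z)^-1 by rewrite invr_ge0 addr_ge0.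
    have iz1 : (1 + z)^-1 <= 1 by rewrite invf_le1 ?lerDl// ltr_wpDr.
    rewrite subr_ge0 /GRing.scale /=.
    (* With [z = y^2], both signs are isolated so that they disappear under the absolute value,
       leaving [z^N / (1 + z) <= z^N]. *)
    have -> : s * ((1 + z)^-1 - (1 - (- z) ^+ N) * (1 + z)^-1)
      = (s * (-1) ^+ N) * (z ^+ N * (1 + z)^-1).
      by rewrite (exprNn z); ring.
    apply: (le_trans (ler_norm _)).
    have ns : `|s| = 1.
      by apply/eqP; rewrite -sqrp_eq1// -normrX s1 normr1.
    rewrite !normrM normrX normrN1 expr1n mulr1 ns mul1r.
    by rewrite !ger0_norm ?exprn_ge0// ler_piMr ?exprn_ge0.
  - by apply: derivable_within_continuous => y _; case: (df y).
by rewrite !fE atan0 mul0r !subr0 mulr0 subr0 addn1 expr0n mul0r subr_ge0.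
Qed.

(** By parity [x >= 0] suffices. For [x > 0], divide the Taylor bound by [x] and use
    [x^(2N) <= 1]. *)
Lemma atan_div_poly_bound (R : realType) (N : nat) (x : R) : `|x| <= 1 ->
  `|atan_div x - (atan_div_poly R N).[x]| <= (2 * N + 1)%:R^-1.
Proof.
wlog x0 : x / 0 <= x => [hw|].
  have [x0|/ltW x0] := leP 0 x; first exact: hw.
  move=> x1; have := hw (- x); rewrite oppr_ge0 normrN => /(_ x0 x1).
  by rewrite hornerN_atan_div_poly /atan_div oppr_eq0 atanN invrN mulrNN.
rewrite ger0_norm// => x1; rewrite /atan_div.
have [->|xn0] := eqVneq x 0.
  (* At [x = 0] the empty polynomial gives the error 1, which is exactly the bound; any other
     polynomial has constant term 1 and no error. *)
  case: N => [|N].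
    by rewrite /atan_div_poly big_ord0 horner0 subr0 normr1 muln0 invr1.
  rewrite horner_sum big_ord_recl big1/= => [|i _].
    by rewrite !hornerE invr1 subrr normr0 invr_ge0 ler0n.
  by rewrite hornerZ hornerXn expr0n/= mulr0.
have xp : 0 < x by rewrite lt0r xn0.
rewrite -(ler_pM2l xp) -{1}(ger0_norm x0) -normrM mulrBr mulrCA divff// mulr1.
apply: (@le_trans _ _ (x ^+ (2 * N + 1) / (2 * N + 1)%:R)).
  rewrite ler_norml; apply/andP; split.
    by rewrite lerNl -[leLHS]mulN1r; apply: atan_taylor_bound; rewrite // sqrrN expr1n.
  by rewrite -[leLHS]mul1r; apply: atan_taylor_bound; rewrite // expr1n.
rewrite ler_pM2r ?invr_gt0 ?ltr0n ?addn1// exprS ler_piMr//.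
exact: exprn_ile1.
Qed.

Lemma cvg_atan_div_poly (R : realType) (x : R) : `|x| <= 1 ->
  (atan_div_poly R n).[x] @[n --> \oo] --> atan_div x.
Proof.
move=> x1.
apply/subr_cvg0; apply: norm_cvg0;
 apply: (squeeze_cvgr _ (cvg_cst 0) (@cvg_harmonic R)).
near=> n; rewrite normr_ge0/= distrC; apply: (le_trans (atan_div_poly_bound _ n _ x1)).
(* The bound [1/(2n+1)] is compared with the harmonic term [1/(n+1)]. *)
rewrite lef_pV2 ?posrE ?ltr0n ?addn1// ler_nat ltnS; exact: leq_pmull.
Unshelve. all: by end_near.
Qed.

(** Negation preserves both Lebesgue measure and the centered segment, so this is the pushforward
    formula for [-%R]. *)
Lemma integral_centeredN (R : realType) (a : R) (f : R -> R) :
  measurable_fun setT f ->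
  lebesgue_measure.-integrable `[(- a)%R, a] (EFin \o (f \o -%R)) ->
  (\int[lebesgue_measure]_(x in `[(- a)%R, a]) (f x)%:E =
   \int[lebesgue_measure]_(x in `[(- a)%R, a]) (f (- x))%:E)%E.
Proof.
move=> mf intf.
have eD : (-%R : R -> measurableTypeR R) @^-1` `[(- a)%R, a] = `[(- a)%R, a]%classic.
  by rewrite opp_preimage_itvbndbnd opprK.
rewrite -[in RHS]eD.
rewrite -(@integral_pushforward _ _ (measurableTypeR R) (measurableTypeR R) R
  (-%R : _ -> measurableTypeR R) _ lebesgue_measure _ (EFin \o f)).
- by apply: eq_measure_integral => //= A mA AS; exact/esym/lebesgue_measureN.
- exact: oppr_measurable.
- exact/measurable_EFinP.
- by rewrite eD.
- by [].
Qed.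

(** Reflection turns [G x * f x] into [(1 - G x) * f x], so the integral [I] satisfies
    [I = 2c - I]. *)
Lemma integral_symmetric_weight (R : realType) (G f : R -> R) (a c : R) :
  measurable_fun setT G -> (forall x, 0 <= G x <= 1) ->
  (forall x, G x = 1 - G (- x)) ->
  continuous f -> (forall x, f (- x) = f x) ->
  (\int[lebesgue_measure]_(x in `[(- a)%R, a]) (f x)%:E = (c + c)%:E)%E ->
  (\int[lebesgue_measure]_(x in `[(- a)%R, a]) (G x * f x)%:E = c%:E)%E.
Proof.
move=> mG G01 Gsym cf fN intf.
have mf : measurable_fun setT f by exact: continuous_measurable_fun.
have mGf : measurable_fun setT (fun x => G x * f x) by exact: measurable_funM.
have if_ : lebesgue_measure.-integrable `[(- a)%R, a] (EFin \o f).
  apply: continuous_compact_integrable; first exact: segment_compact.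
  exact: continuous_subspaceT.
have iGf : lebesgue_measure.-integrable `[(- a)%R, a]
    (EFin \o (fun x => G x * f x)).
  apply: le_integrable if_ => //.
    by apply/measurable_EFinP; exact: measurable_funTS.
  move=> x _ /=; rewrite lee_fin normrM ler_piMl//.
  by have /andP[? ?] := G01 x; rewrite ger0_norm.
have iGfN : lebesgue_measure.-integrable `[(- a)%R, a]
    (EFin \o ((fun x => G x * f x) \o -%R)).
  rewrite (_ : _ \o _ = (EFin \o f) \- (EFin \o (fun x => (G x * f x)%R)))%E.
    exact: integrableB.
  by apply/funext => x /=; rewrite fN Gsym opprK -EFinB; congr EFin; ring.
have := @integral_centeredN R a _ mGf iGfN.
rewrite [X in _ = X -> _](_ : _ = \int[lebesgue_measure]_(x in `[(- a)%R, a])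
    ((f x)%:E - (G x * f x)%:E))%E; last first.
  apply: eq_integral => x _; rewrite fN Gsym opprK -EFinB; congr EFin; ring.
rewrite integralB// intf.
(* Finiteness brings this equation from the extended reals down to [R], where it can be solved for
   [I]. *)
have : (\int[lebesgue_measure]_(x in `[(- a)%R, a]) (G x * f x)%:E)%E
  \is a fin_num by exact: integrable_fin_num.
case: (integral _ _ _) => // I _ [] IE; congr EFin; lra.
Qed.

Theorem theorem2 (R : realType) (G : R -> R)
  (G01 : forall x, 0 <= G x <= 1)
  (Grc : right_continuous G)
  (Gnd : nondecreasing G)
  (GNy : G x @[x --> -oo] --> (0 : R))
  (Gy : G x @[x --> +oo] --> (1 : R))
  (Gsym : forall x, G x = 1 - G (- x)) :
  ((catalan R)%:E =
   \int[lebesgue_measure]_(x in `[(-1)%R, 1%R]) (G x * atan_div x)%:E)%E.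
Proof.
have mG : measurable_fun setT G by exact: nondecreasing_measurable.
pose p n x : R := (atan_div_poly R n).[x].
have mp n : measurable_fun `[(-1 : R), 1] (p n).
  apply: measurable_funTS; apply: continuous_measurable_fun.
  exact: continuous_horner.
have x1 (x : R) : `[(-1 : R), 1]%classic x -> `|x| <= 1.
  by rewrite /= in_itv /= ler_norml.
have intp n : (\int[lebesgue_measure]_(x in `[(-1)%R, 1%R]) (G x * p n x)%:E
    = (series (@catalan_term R) n)%:E)%E.
  apply: integral_symmetric_weight => //.
  - exact: continuous_horner.
  - exact: hornerN_atan_div_poly.
  (* The primitive is odd, so its increment over [[-1, 1]] is twice its value at 1, that is, the
     partial sum added to itself. *)
  rewrite (@continuous_FTC2 R _ (horner (atan_div_primitive R n))).
  - by rewrite -EFinB hornerN_atan_div_primitive opprK atan_div_primitive1.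
  - by rewrite gtrN.
  - by apply: continuous_subspaceT; exact: continuous_horner.
  - split.
    + by move=> x _; exact: derivable_horner.
    + by apply: cvg_at_right_filter; exact: continuous_horner.
    + by apply: cvg_at_left_filter; exact: continuous_horner.
  - by move=> x _; rewrite -derivE deriv_atan_div_primitive.
have cvgI : ((series (@catalan_term R) n)%:E
    @[n --> \oo] -->
    \int[lebesgue_measure]_(x in `[(-1)%R, 1%R]) (G x * atan_div x)%:E)%E.
  under eq_fun do rewrite -intp.
  apply: (@dominated_cvg _ _ R lebesgue_measure `[(-1 : R), 1]
    (measurable_itv _) (fun n x => (G x * p n x)%:E)
    (fun x => (G x * atan_div x)%:E) (cst 2%:E)).
  - move=> n; apply/measurable_EFinP; apply: measurable_funM; last exact: mp.
    exact: measurable_funTS.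
  - move=> x xD; have xle : `|x| <= 1 by exact: x1.
    apply: cvg_EFin; first exact: nearW.
    by apply: cvgMr; exact: cvg_atan_div_poly.
  - by [].
  - have : lebesgue_measure.-integrable `[(-1 : R), 1] (EFin \o @cst R R 2).
      apply: continuous_compact_integrable; first exact: segment_compact.
      by apply: continuous_subspaceT => ?; exact: cvg_cst.
    by [].
  - move=> n x xD; have xle : `|x| <= 1 by exact: x1.
    rewrite /= lee_fin normrM.
    have /andP[G0 G1] := G01 x.
    rewrite (ger0_norm G0) (le_trans (ler_piMl _ G1))//.
    (* The dominating constant 2 arises here: the bound at [N = 0] reads [|atan_div x| <= 1], and
       each polynomial stays within 1 of [atan_div x]. *)
    have := atan_div_poly_bound _ 0 _ xle.
    rewrite {1}/atan_div_poly big_ord0 horner0 subr0 invr1 => h0.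
    rewrite /p -[X in `|X|](subKr (atan_div x)) (le_trans (ler_normB _ _))//.
    apply: lerD => //; apply: (le_trans (atan_div_poly_bound _ n _ xle)).
    by rewrite invf_le1 ?ltr0n ?ler1n addn1.
(* The partial sums tend to the integral by [cvgI], and to [catalan R] because [is_cvg_catalan]
   makes its [limn] a genuine limit. *)
apply/esym; apply: (cvg_unique _ cvgI) => //.
apply: cvg_EFin; first exact: nearW.
exact: is_cvg_catalan.
Qed.
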